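(* Let $k_1^1, \dots, k_n^1$ and $k_1^2, \dots, k_n^2$ be two Steiner chains, for the pairs of circles $l_1, m_1$ and $l_2, m_2$ respectively, with common circle $k_1^1=k_1^2$, such that there exists an inversion $\psi$ mapping $l_1$ and $m_1$ to two concentric circles and also mapping $l_2$ and $m_2$ to two concentric circles. Then: (1) For all $i, j$ the points $N_i^1, N_j^1, N_i^2, N_j^2$ lie on the same circle $c_{i,j}$. (2) For all $i, j$ the points $M_i^1, M_j^1, M_i^2, M_j^2$ lie on the same circle $c^M_{i,j}$. (3) For all $i, j$ the points $L_i^1, L_j^1, L_i^2, L_j^2$ lie on the same circle $c^L_{i,j}$. (4) For all $i$ the points $L_i^1, M_i^1, L_i^2, M_i^2$ lie on the same circle $c_i$.
   Context: A Steiner chain of $n$ circles for two non-intersecting circles $l$ and $m$ in the plane is a sequence of pairwise distinct circles $k_1, \dots, k_n$, each tangent to both $l$ and $m$, such that $k_i$ and $k_{i+1}$ are mutually tangent for all $i$, where indices are taken modulo $n$ (so the last circle $k_n$ is tangent to the first circle $k_1$). For the two chains ($s\in\{1,2\}$): $L_i^s$ is the tangency point of $k_i^s$ and $l_s$; $M_i^s$ is the tangency point of $k_i^s$ and $m_s$; $N_i^s$ is the tangency point of $k_i^s$ and $k_{i+1}^s$.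
   Formalization: Added: n≥3; after ψ the two chains wind equally often in opposite directions about their centres (no step through the centre); for (2),(3) the images of l_1, l_2 are both inner or both outer; ''circle'' may be a line. Without these the claim fails. *)

(* Defs.v *)
From HB Require Import structures.
From mathcomp Require Import all_boot all_order all_algebra.
From mathcomp Require Import reals trigo.

Set Implicit Arguments.
Unset Strict Implicit.
Unset Printing Implicit Defensive.

Import Order.TTheory GRing.Theory Num.Theory.
Local Open Scope ring_scope.

(* The Euclidean plane is [R * R]. The product norm of mathcomp-analysis is
   the sup norm, hence the explicit squared distance. *)
Definition sqdist (R : realType) (P Q : R * R) : R :=
  (P.1 - Q.1) ^+ 2 + (P.2 - Q.2) ^+ 2.

Record circle (R : realType) := Circle {
  ccenter : R * R;
  cradius : R;
  cradius_gt0 : 0 < cradius }.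

Definition on_circle (R : realType) (C : circle R) (P : R * R) : Prop :=
  sqdist P (ccenter C) = cradius C ^+ 2.

(* Two circles are tangent when they have exactly one common point; both
   internal and external tangency are allowed. *)
Definition tangent_at (R : realType) (C D : circle R) (P : R * R) : Prop :=
  forall X, on_circle C X /\ on_circle D X <-> X = P.

Definition tangent (R : realType) (C D : circle R) : Prop :=
  exists P, tangent_at C D P.

Definition non_intersecting (R : realType) (C D : circle R) : Prop :=
  forall X, ~ (on_circle C X /\ on_circle D X).

Definition concentric (R : realType) (C D : circle R) : Prop :=
  ccenter C = ccenter D.

(* [ordS] is the successor modulo [n]. *)
Definition steiner_chain (R : realType) (n : nat) (l m : circle R)
    (k : 'I_n -> circle R) : Prop :=
  [/\ non_intersecting l m,
      injective k,
      forall i, tangent (k i) l /\ tangent (k i) m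
    & forall i, tangent (k i) (k (ordS i))].

(* Inversion in the circle [w]. At the pole [ccenter w], whose
   image is the point at infinity, the value is meaningless. *)
Definition inversion (R : realType) (w : circle R) (P : R * R) : R * R :=
  let O := ccenter w in
  let t := cradius w ^+ 2 / sqdist P O in
  (O.1 + t * (P.1 - O.1), O.2 + t * (P.2 - O.2)).

(* A circle through the pole is mapped to a line, never to a circle. *)
Definition inverts_to (R : realType) (w C D : circle R) : Prop :=
  ~ on_circle C (ccenter w) /\
  forall Y, on_circle D Y <-> exists2 X, on_circle C X & Y = inversion w X.

(* The closed polygon P_0 P_1 ... P_(n-1) P_0 has winding number [t] about
   [O], counted positively counterclockwise. The function [theta] is a lift of
   the argument of P_i - O along the polygon; the strict bound by [pi] says
   that no side passes through [O] and determines the lift up to a multiple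
   of 2 * pi. *)
Definition winds (R : realType) (n : nat) (O : R * R) (P : 'I_n -> R * R)
    (t : int) : Prop :=
  exists theta : nat -> R,
    [/\ forall i : 'I_n, exists2 r : R, 0 < r &
          P i = (O.1 + r * cos (theta i), O.2 + r * sin (theta i)),
        forall i, (i < n)%N -> `|theta i.+1 - theta i| < pi
      & theta n = theta 0 + 2 * pi * t%:~R].

Definition collinear4 (R : realType) (A B C D : R * R) : Prop :=
  exists a b c : R, (a, b) <> (0, 0) /\
    forall X, X \in [:: A; B; C; D] -> a * X.1 + b * X.2 = c.

(* Circles of inversive geometry: a line counts as a circle through the point
   at infinity. *)
Definition same_circle (R : realType) (A B C D : R * R) : Prop :=
  (exists G : circle R, forall X, X \in [:: A; B; C; D] -> on_circle G X) \/
  collinear4 A B C D.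

(* Main.v *)
Require Import Defs.
From mathcomp Require Import all_boot all_order all_algebra.
From mathcomp Require Import reals trigo.
From mathcomp Require Import ring lra zify.

(** After the inversion each chain lies between two concentric circles, and
    such a chain is completely rigid: its circles all have the same radius,
    half the width of the annulus, and their centers, seen from the common
    center, advance by the same angle [phi] at each step
    ([steiner_chain_concentric]). The number [t] of turns gives [phi = 2 pi t / n],
    and tangency of consecutive circles ties [phi] to the ratio of the two radii.

    Two chains with opposite numbers of turns have opposite angles [phi] and
    [- phi], hence the same ratio; sharing a circle, they have the same width
    too. So the two annuli are congruent, with centers at the same distance from
    the center [C] of the common circle, and a reflection in a line through [C]
    swaps these two centers. It sends the direction of the [i]-th circle of one
    chain to that of the [i]-th circle of the other, because the chains turn in
    opposite senses ([reflection_polar]); hence it carries the tangency points of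
    one chain to those of the other (with the roles of the two concentric circles
    exchanged when one [l] is inner and the other is outer).

    Two points and their mirror images lie on a circle or a line
    ([cocyclic_reflection]), and the inversion takes this back to a circle or a
    line through the original points ([cocyclic_inversion]).

    Two degenerate configurations have to be excluded. A chain circle through the
    pole would become a line tangent to two concentric circles of different radii
    ([tangent_circle_misses_pole]). A circle tangent to two concentric circles may
    also enclose the inner one. Such a circle can only touch chain circles that
    lie between the two; since the chain does not jump to the opposite side of the
    center in one step, both neighbors would be in the same direction, hence
    equal, although [n] is at least 3. *)

Set Implicit Arguments.
Unset Strict Implicit.
Unset Printing Implicit Defensive.

Import Order.TTheory GRing.Theory Num.Theory.
Local Open Scope ring_scope.

(** * Inversion acting on circles *)

Lemma sqdist_eq0 (R : realType) (P Q : R * R) : sqdist P Q = 0 <-> P = Q.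
Proof.
case: P Q => [a b] [c d]; rewrite /sqdist /=; split=> [/eqP|[-> ->]]; last by ring.
rewrite paddr_eq0 ?sqr_ge0 // !sqrf_eq0 !subr_eq0.
by case/andP=> /eqP-> /eqP->.
Qed.

Lemma sqdist_neq0 (R : realType) (P Q : R * R) : P <> Q -> sqdist P Q != 0.
Proof. by move=> PQ; apply/eqP=> /sqdist_eq0. Qed.

Lemma cradius_sqr_neq0 (R : realType) (C : circle R) : cradius C ^+ 2 != 0.
Proof. by rewrite expf_neq0 // gt_eqF // cradius_gt0. Qed.

Lemma circle_ext (R : realType) (C D : circle R) :
  ccenter C = ccenter D -> cradius C = cradius D -> C = D.
Proof.
case: C D => [c r r0] [d s s0] /= Ec Er; subst d s.
by rewrite (bool_irrelevance r0 s0).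
Qed.

(** The four points of [C] in the axis directions already determine [D]. *)
Lemma circle_eq_points (R : realType) (C D : circle R) :
  (forall X, on_circle C X -> on_circle D X) -> C = D.
Proof.
case: C D => [[a b] r r0] [[c d] s s0] CD.
(* Points of [C] in the direction of a unit vector. *)
have on_r u v : u ^+ 2 + v ^+ 2 = 1 ->
    (a + r * u - c) ^+ 2 + (b + r * v - d) ^+ 2 = s ^+ 2.
  move=> uv; have := CD (a + r * u, b + r * v); rewrite /on_circle /sqdist /=.
  apply; transitivity (r ^+ 2 * (u ^+ 2 + v ^+ 2)); first by ring.
  by rewrite uv mulr1.
have rn0 : r != 0 by rewrite gt_eqF.
have E1 := on_r 1 0 ltac:(by ring); have E2 := on_r (-1) 0 ltac:(by ring).
have E3 := on_r 0 1 ltac:(by ring); have E4 := on_r 0 (-1) ltac:(by ring).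
have ac : a - c = 0.
  by apply: (mulfI rn0); rewrite mulr0; lra.
have bd : b - d = 0.
  by apply: (mulfI rn0); rewrite mulr0; lra.
apply: circle_ext => /=; first by rewrite (subr0_eq ac) (subr0_eq bd).
have : (r - s) * (r + s) = 0 by rewrite (subr0_eq ac) (subr0_eq bd) in E1; lra.
by move/eqP; rewrite mulf_eq0 => /orP[/eqP|/eqP]; lra.
Qed.

Lemma inversion_sqdist (R : realType) (w : circle R) (P : R * R) :
  P <> ccenter w ->
  sqdist (inversion w P) (ccenter w) = cradius w ^+ 4 / sqdist P (ccenter w).
Proof.
move=> /sqdist_neq0; case: w P => [[a b] r r0] [x y]; rewrite /inversion /sqdist /= => q0.
by field.
Qed.

Lemma inversion_neq_pole (R : realType) (w : circle R) (P : R * R) :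
  P <> ccenter w -> inversion w P <> ccenter w.
Proof.
move=> Pw /sqdist_eq0; rewrite inversion_sqdist // => /eqP.
rewrite mulf_eq0 invr_eq0 (negPf (sqdist_neq0 Pw)) orbF expf_eq0 /=.
by rewrite gt_eqF // cradius_gt0.
Qed.

Lemma inversionK (R : realType) (w : circle R) (P : R * R) :
  P <> ccenter w -> inversion w (inversion w P) = P.
Proof.
move=> Pw; have q0 := sqdist_neq0 Pw.
rewrite {1}/inversion inversion_sqdist //; have := cradius_gt0 w.
case: w P {Pw} q0 => [[a b] r r0] [x y] /=; rewrite /sqdist /= => q0 r1.
by congr pair; field; rewrite q0 gt_eqF.
Qed.

Lemma inverts_to_on (R : realType) (w C D : circle R) (X : R * R) :
  inverts_to w C D -> X <> ccenter w ->
  on_circle D (inversion w X) <-> on_circle C X.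
Proof.
move=> [wC CD] Xw; split=> [/CD[X' CX' eqX]|CX]; last by apply/CD; exists X.
have X'w : X' <> ccenter w by move=> e; apply: wC; rewrite -e.
by rewrite -(inversionK Xw) eqX inversionK.
Qed.

Lemma on_inverts_to (R : realType) (w C D : circle R) (Y : R * R) :
  inverts_to w C D -> on_circle D Y ->
  Y <> ccenter w /\ on_circle C (inversion w Y).
Proof.
move=> [wC CD] /CD[X CX ->].
have Xw : X <> ccenter w by move=> e; apply: wC; rewrite -e.
by split; [exact: inversion_neq_pole | rewrite inversionK].
Qed.

Lemma tangent_at_on (R : realType) (C D : circle R) (P : R * R) :
  tangent_at C D P -> on_circle C P /\ on_circle D P.
Proof. by move=> tP; apply/tP. Qed.

(** Inversion is a bijection away from the pole, so it preserves having exactly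
    one common point. *)
Lemma tangent_at_inversion (R : realType) (w C D C' D' : circle R) (P : R * R) :
  inverts_to w C C' -> inverts_to w D D' ->
  tangent_at C D P -> tangent_at C' D' (inversion w P).
Proof.
move=> iC iD tP Y; split=> [[CY DY]|->].
  have [Yw CY'] := on_inverts_to iC CY; have [_ DY'] := on_inverts_to iD DY.
  by rewrite -(inversionK Yw); congr inversion; apply/tP.
have [CP DP] := tangent_at_on tP.
have Pw : P <> ccenter w by move=> e; case: iC => wC _; apply: wC; rewrite -e.
by split; apply/inverts_to_on; eauto.
Qed.

(** [p] is the power of the pole with respect to [C]; multiplying the equation
    of [C] at [inversion w Y] by the squared distance from [Y] to the pole gives
    [p] times the equation of [D] at [Y]. *)
Lemma on_circle_inversion (R : realType) (w C D : circle R) (Y : R * R) (p : R) :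
  p = sqdist (ccenter C) (ccenter w) - cradius C ^+ 2 -> p != 0 ->
  ccenter D = ((ccenter w).1 + cradius w ^+ 2 * ((ccenter C).1 - (ccenter w).1) / p,
               (ccenter w).2 + cradius w ^+ 2 * ((ccenter C).2 - (ccenter w).2) / p) ->
  cradius D = cradius w ^+ 2 * cradius C / `|p| ->
  Y <> ccenter w -> on_circle C (inversion w Y) <-> on_circle D Y.
Proof.
move=> pE p0 Dc Dr Yw; rewrite /on_circle Dc Dr {Dc Dr}.
rewrite expr_div_n real_normK ?num_real //.
move/sqdist_neq0: Yw; rewrite /inversion.
case: w C Y pE => [[a b] s s0] [[c d] r r0] [x y]; rewrite /sqdist /= => pE q0.
set A := (X in X = _); set B := (X in _ <-> X = _); set E := (X in _ <-> _ = X).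
have key : (A - r ^+ 2) * ((x - a) ^+ 2 + (y - b) ^+ 2) = (B - E) * p.
  by rewrite pE in p0 *; rewrite /A /B /E pE; field; rewrite q0 p0.
split=> e; apply/eqP; rewrite -subr_eq0; apply/eqP.
  by apply: (mulIf p0); rewrite -key e subrr !mul0r.
by apply: (mulIf q0); rewrite key e subrr !mul0r.
Qed.

Lemma inverts_to_exists (R : realType) (w C : circle R) :
  ~ on_circle C (ccenter w) -> exists C', inverts_to w C C'.
Proof.
move=> wC; pose p := sqdist (ccenter C) (ccenter w) - cradius C ^+ 2.
have p0 : p != 0.
  apply/eqP=> /subr0_eq e; apply: wC; rewrite /on_circle -e.
  by rewrite /sqdist; ring.
have r'0 : 0 < cradius w ^+ 2 * cradius C / `|p|.
  by rewrite divr_gt0 ?mulr_gt0 ?exprn_gt0 ?normr_gt0 ?cradius_gt0.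
pose D := Circle
  ((ccenter w).1 + cradius w ^+ 2 * ((ccenter C).1 - (ccenter w).1) / p,
   (ccenter w).2 + cradius w ^+ 2 * ((ccenter C).2 - (ccenter w).2) / p) r'0.
have CD Y : Y <> ccenter w -> on_circle C (inversion w Y) <-> on_circle D Y.
  exact: on_circle_inversion.
exists D; split=> // Y; split=> [DY|[X CX ->]].
  have Yw : Y <> ccenter w.
    move=> e; move: DY; rewrite e /on_circle /D /sqdist /= => {}e.
    have rp : cradius w ^+ 2 / p != 0.
      by rewrite mulf_neq0 ?invr_eq0 // cradius_sqr_neq0.
    apply: (elimN eqP p0); apply: (mulfI (expf_neq0 2 rp)); rewrite mulr0.
    move: e; rewrite expr_div_n real_normK ?num_real // -/p => /eqP.
    rewrite -subr_eq0 => /eqP <-; rewrite {2}/p /sqdist; field; exact: p0.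
  by exists (inversion w Y); [apply/CD | rewrite inversionK].
have Xw : X <> ccenter w by move=> e; apply: wC; rewrite -e.
apply/CD; first exact: inversion_neq_pole.
by rewrite inversionK.
Qed.

Lemma inverts_to_inj (R : realType) (w C1 C2 D : circle R) :
  inverts_to w C1 D -> inverts_to w C2 D -> C1 = C2.
Proof.
move=> i1 i2; apply: circle_eq_points => X CX.
have Xw : X <> ccenter w by move=> e; case: i1 => wC _; apply: wC; rewrite -e.
by apply/(inverts_to_on i2 Xw)/(inverts_to_on i1 Xw).
Qed.

Lemma inverts_to_unique (R : realType) (w C D1 D2 : circle R) :
  inverts_to w C D1 -> inverts_to w C D2 -> D1 = D2.
Proof.
by move=> [_ i1] [_ i2]; apply: circle_eq_points => Y /i1 CY; apply/i2.
Qed.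

Lemma tangent_at_neq_pole (R : realType) (w C C' D : circle R) (P : R * R) :
  inverts_to w C C' -> tangent_at C D P -> P <> ccenter w.
Proof. by move=> [wC _] /tangent_at_on[CP _] E; apply: wC; rewrite -E. Qed.

(** * Circles and lines as one family *)

(** The equation is centered at a base point so that inversion with pole [O]
    merely exchanges its quadratic and constant coefficients. *)
Definition gen_circle_eq (R : realType) (O : R * R) (a b c d : R) (X : R * R) :=
  a * sqdist X O + b * (X.1 - O.1) + c * (X.2 - O.2) + d = 0.

(** A nonzero constant equation is allowed, since it has no solution; this
    makes the notion visibly invariant under inversion. *)
Definition cocyclic (R : realType) (O : R * R) (s : seq (R * R)) : Prop :=
  exists a b c d : R, (a, b, c, d) <> (0, 0, 0, 0) /\
    forall X, X \in s -> gen_circle_eq O a b c d X.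

Lemma cocyclic_sub (R : realType) (O : R * R) (s s' : seq (R * R)) :
  {subset s' <= s} -> cocyclic O s -> cocyclic O s'.
Proof.
move=> ss' [a [b [c [d [nz sP]]]]]; exists a, b, c, d; split=> // X Xs'.
exact/sP/ss'.
Qed.

Lemma cocyclic_base (R : realType) (O O' : R * R) (s : seq (R * R)) :
  cocyclic O s -> cocyclic O' s.
Proof.
move=> [a [b [c [d [nz sP]]]]].
pose u := O'.1 - O.1; pose v := O'.2 - O.2.
exists a, (b + 2 * a * u), (c + 2 * a * v),
  (a * (u ^+ 2 + v ^+ 2) + b * u + c * v + d); split=> [[a0 b0 c0 d0]|X /sP].
  rewrite a0 !(mulr0, mul0r, addr0, add0r) in b0 c0 d0.
  rewrite b0 c0 !(mul0r, add0r) in d0.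
  by apply: nz; rewrite a0 b0 c0 d0.
by rewrite /gen_circle_eq /sqdist => <-; rewrite /u /v; ring.
Qed.

(** Dividing the equation at [inversion w X] by the squared distance from [X] to
    the pole turns it into an equation of the same form at [X]. *)
Lemma cocyclic_inversion (R : realType) (w : circle R) (s : seq (R * R)) :
  (forall X, X \in s -> X <> ccenter w) ->
  cocyclic (ccenter w) [seq inversion w X | X <- s] ->
  cocyclic (ccenter w) s.
Proof.
move=> sw [a [b [c [d [nz sP]]]]].
have r0 := cradius_sqr_neq0 w.
have r4 : cradius w ^+ 4 != 0 by rewrite (exprM _ 2 2) expf_neq0.
exists d, (b * cradius w ^+ 2), (c * cradius w ^+ 2), (a * cradius w ^+ 4).
split=> [[d0 b0 c0 a0]|X Xs].
  move/eqP: b0; rewrite mulf_eq0 (negPf r0) orbF => /eqP b0.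
  move/eqP: c0; rewrite mulf_eq0 (negPf r0) orbF => /eqP c0.
  move/eqP: a0; rewrite mulf_eq0 (negPf r4) orbF.
  by move=> /eqP a0; apply: nz; rewrite a0 b0 c0 d0.
have Xw := sw X Xs; have q0 := sqdist_neq0 Xw.
have := sP _ (map_f _ Xs).
rewrite /gen_circle_eq inversion_sqdist // /inversion /=.
set q := sqdist _ _ in q0 *; move/(congr1 (fun z => z * q)); rewrite mul0r => <-.
by field.
Qed.

(** The degenerate equation of a circle of radius zero forces the four points
    to coincide, and then they are collinear. *)
Lemma cocyclic_same_circle (R : realType) (O A B C D : R * R) :
  cocyclic O [:: A; B; C; D] -> same_circle A B C D.
Proof.
move=> [a [b [c [d [nz sP]]]]].
have [a0|a0] := eqVneq a 0.
  right; exists b, c, (b * O.1 + c * O.2 - d); split=> [[b0 c0]|X /sP].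
    apply: nz; have := sP A (mem_head _ _).
    by rewrite /gen_circle_eq a0 b0 c0 !mul0r !add0r => ->.
  by rewrite /gen_circle_eq a0 => e; lra.
pose Z := (O.1 - b / (2 * a), O.2 - c / (2 * a)).
have ZP X : X \in [:: A; B; C; D] -> sqdist X Z = sqdist A Z.
  have E Y : Y \in [:: A; B; C; D] ->
      sqdist Y Z = (b ^+ 2 + c ^+ 2) / (4 * a ^+ 2) - d / a.
    move/sP; rewrite /gen_circle_eq => /(congr1 (fun z => z / a)).
    rewrite mul0r => e; apply: subr0_eq; rewrite -e /sqdist /Z /=; field.
    exact: a0.
  by move/E->; rewrite (E A (mem_head _ _)).
have : 0 <= sqdist A Z by rewrite addr_ge0 // sqr_ge0.
rewrite le0r => /orP[/eqP AZ|AZ]; last first.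
  have r0 : 0 < Num.sqrt (sqdist A Z) by rewrite sqrtr_gt0.
  left; exists (Circle Z r0) => X /ZP; rewrite /on_circle /= => ->.
  by rewrite sqr_sqrtr // ltW.
right; exists 1, 0, Z.1; split=> [[/eqP]|X /ZP]; first by rewrite oner_eq0.
by rewrite AZ => /sqdist_eq0 ->; ring.
Qed.

(** The reflection in the line through [C] of direction [g]. *)
Definition reflection (R : realType) (C : R * R) (g : R) (X : R * R) : R * R :=
  let u := (X.1 - C.1) * cos g + (X.2 - C.2) * sin g in
  (C.1 + (2 * u * cos g - (X.1 - C.1)), C.2 + (2 * u * sin g - (X.2 - C.2))).

(** Both a circle centered on the axis and a line perpendicular to it are
    symmetric; one of these contains [P] and [Q]: the circle when [P] and [Q] have
    different projections on the axis, the line otherwise. *)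
Lemma cocyclic_reflection (R : realType) (C P Q : R * R) (g : R) :
  cocyclic C [:: P; Q; reflection C g P; reflection C g Q].
Proof.
pose u (X : R * R) := (X.1 - C.1) * cos g + (X.2 - C.2) * sin g.
have cs : sin g ^+ 2 = 1 - cos g ^+ 2 by rewrite -(cos2Dsin2 g); ring.
(* An equation in [u] and the distance to [C] is invariant under the
   reflection, as [u] is the coordinate along the axis. *)
have symm a b d : (forall X, X \in [:: P; Q] ->
      a * sqdist X C + b * u X + d = 0) ->
    forall X, X \in [:: P; Q; reflection C g P; reflection C g Q] ->
      gen_circle_eq C a (b * cos g) (b * sin g) d X.
  move=> PQ; have PQ' X : X \in [:: P; Q] ->
      gen_circle_eq C a (b * cos g) (b * sin g) d X /\
      gen_circle_eq C a (b * cos g) (b * sin g) d (reflection C g X).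
    move/PQ; rewrite /gen_circle_eq /u /reflection /sqdist /= => e.
    by split; rewrite -e; ring: cs.
  have [P1 P2] := PQ' P (mem_head _ _).
  have [Q1 Q2] := PQ' Q ltac:(by rewrite !inE eqxx orbT).
  by move=> X; rewrite !inE => /or4P[]/eqP->.
have [uE|uN] := eqVneq (u P) (u Q).
  exists 0, (1 * cos g), (1 * sin g), (- u P); split.
    by rewrite !mul1r => -[c0 s0 _]; move: cs; rewrite c0 s0; lra.
  apply: symm => X; rewrite !inE => /orP[]/eqP-> ; rewrite ?uE; ring.
pose a := u P - u Q; pose b := sqdist Q C - sqdist P C.
exists a, (b * cos g), (b * sin g), (- a * sqdist P C - b * u P); split.
  by case=> /subr0_eq uE; move: uN; rewrite uE eqxx.
by apply: symm => X; rewrite !inE => /orP[]/eqP->; rewrite /a /b; ring.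
Qed.

(** * Tangency *)

(** The reflection in the line of centers preserves both circles, so it fixes
    their only common point. For equal centers the point reflection in the center
    plays the same role. *)
Lemma tangent_at_collinear (R : realType) (C D : circle R) (P : R * R) :
  tangent_at C D P ->
  ccenter C <> ccenter D /\
  exists x, P = ((ccenter C).1 + x * ((ccenter D).1 - (ccenter C).1),
                 (ccenter C).2 + x * ((ccenter D).2 - (ccenter C).2)).
Proof.
move=> tP; have [CP DP] := tangent_at_on tP.
have CD : ccenter C <> ccenter D.
  move=> cE; pose P' := (2 * (ccenter C).1 - P.1, 2 * (ccenter C).2 - P.2).
  have P'E Z : Z = ccenter C -> sqdist P' Z = sqdist P Z.
    by move=> ->; rewrite /sqdist /P' /=; ring.
  have PP' : P' = P by apply/tP; split; rewrite /on_circle P'E.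
  case/eqP: (cradius_sqr_neq0 C); rewrite -CP; apply/sqdist_eq0.
  have /= e1 := congr1 fst PP'; have /= e2 := congr1 snd PP'.
  by rewrite [P]surjective_pairing [RHS]surjective_pairing; congr pair; lra.
split=> //; have D0 := sqdist_neq0 (nesym CD).
move: tP CP DP D0 {CD}; rewrite /tangent_at /on_circle.
case: C D P => [[a b] r r0] [[c d] s s0] [x y]; rewrite /sqdist /=.
move=> tP CP DP D0; set q := _ + _ in D0.
pose z := ((x - a) * (c - a) + (y - b) * (d - b)) / q.
(* The pair below is the mirror image of [P] in the line of centers. *)
exists z; have [e1 e2] : (a + 2 * z * (c - a) - (x - a),
                          b + 2 * z * (d - b) - (y - b)) = (x, y).
  by apply/tP; rewrite /= -CP -DP; split; rewrite /z /q; field; exact: D0.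
by congr pair; lra.
Qed.

(** The circle [k] becomes a line, with normal vector [e]; the image of [P] is the
    foot of the perpendicular to it from the center of [l'], because the mirror
    image of a common point in this perpendicular is again a common point. *)
Lemma tangent_inverted_line (R : realType) (w k l l' : circle R) (P : R * R)
    (e := ((ccenter k).1 - (ccenter w).1, (ccenter k).2 - (ccenter w).2))
    (z := (cradius w ^+ 2 / 2 - e.1 * ((ccenter l').1 - (ccenter w).1)
             - e.2 * ((ccenter l').2 - (ccenter w).2)) / (e.1 ^+ 2 + e.2 ^+ 2)) :
  on_circle k (ccenter w) -> inverts_to w l l' -> tangent_at k l P ->
  inversion w P = ((ccenter l').1 + z * e.1, (ccenter l').2 + z * e.2).
Proof.
move=> kw il tP; have [kP lP] := tangent_at_on tP.
have line Y : Y <> ccenter w -> on_circle k (inversion w Y) <->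
    2 * (e.1 * (Y.1 - (ccenter w).1) + e.2 * (Y.2 - (ccenter w).2)) =
      cradius w ^+ 2.
  move=> /sqdist_neq0; move: kw; rewrite /on_circle => <-; rewrite /inversion.
  have := cradius_sqr_neq0 w.
  clear z; rewrite {}/e; case: w k {il kP tP} Y => [[a b] s s0] [[c d] r r0] [x y].
  rewrite /sqdist /= => s1 q0; split=> [E|<-]; last by field.
  apply/eqP; rewrite -subr_eq0; apply/eqP; apply: (mulfI s1); rewrite mulr0.
  move/eqP: E; rewrite -subr_eq0 => /eqP/(congr1 (fun t => - t * ((x - a) ^+ 2 + (y - b) ^+ 2))).
  by rewrite oppr0 mul0r => <-; field.
have Pw : P <> ccenter w by move=> E; case: il => wl _; apply: wl; rewrite -E.
have eN0 : e.1 ^+ 2 + e.2 ^+ 2 != 0.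
  rewrite /e /= -[X in X != _]/(sqdist (ccenter k) (ccenter w)).
  apply: sqdist_neq0 => E; move: kw; rewrite /on_circle E.
  move/eqP; have /sqdist_eq0 -> : ccenter w = ccenter w by [].
  by rewrite eq_sym (negPf (cradius_sqr_neq0 k)).
have l'P : on_circle l' (inversion w P) by apply/inverts_to_on; eauto.
have lineP := (line _ (inversion_neq_pole Pw)).1.
rewrite inversionK // in lineP; have {}lineP := lineP kP.
have zE : z * (e.1 ^+ 2 + e.2 ^+ 2) = cradius w ^+ 2 / 2
    - e.1 * ((ccenter l').1 - (ccenter w).1)
    - e.2 * ((ccenter l').2 - (ccenter w).2) by rewrite /z mulfVK.
have [Y YE] : exists Y, Y = inversion w P by eexists.
rewrite -YE in l'P lineP *; clearbody z e.
have {}zE : z * (e.1 ^+ 2 + e.2 ^+ 2) =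
    e.1 * (Y.1 - (ccenter l').1) + e.2 * (Y.2 - (ccenter l').2).
  by rewrite zE -lineP; lra.
pose Y' := (2 * ((ccenter l').1 + z * e.1) - Y.1,
            2 * ((ccenter l').2 + z * e.2) - Y.2).
have l'Y' : on_circle l' Y'.
  rewrite /on_circle -l'P; apply: subr0_eq.
  transitivity (4 * z * (z * (e.1 ^+ 2 + e.2 ^+ 2) -
    (e.1 * (Y.1 - (ccenter l').1) + e.2 * (Y.2 - (ccenter l').2)))).
    by rewrite /sqdist /Y' /=; ring.
  by rewrite zE subrr mulr0.
have [Y'w lY'] := on_inverts_to il l'Y'.
have kY' : on_circle k (inversion w Y') by apply/line => //=; lra.
have YY' : Y' = Y by rewrite YE -(inversionK Y'w); congr inversion; apply/tP.
have /= e1 := congr1 fst YY'; have /= e2 := congr1 snd YY'.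
by rewrite [LHS]surjective_pairing; congr pair; lra.
Qed.

(** The foot of the perpendicular from the common center would lie on both
    concentric circles. *)
Lemma tangent_circle_misses_pole (R : realType) (w k l m l' m' : circle R)
    (L M : R * R) :
  inverts_to w l l' -> inverts_to w m m' -> concentric l' m' ->
  non_intersecting l m -> tangent_at k l L -> tangent_at k m M ->
  ~ on_circle k (ccenter w).
Proof.
move=> il im lm' lm tL tM kw; have [_ lL] := tangent_at_on tL.
have [_ mM] := tangent_at_on tM.
have LM : inversion w L = inversion w M.
  by rewrite (tangent_inverted_line kw il tL) (tangent_inverted_line kw im tM) lm'.
apply: (lm L); split=> //; have Lw : L <> ccenter w.
  by move=> E; case: il => wl _; apply: wl; rewrite -E.
have Mw : M <> ccenter w by move=> E; case: im => wm _; apply: wm; rewrite -E.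
by rewrite -(inversionK Lw) LM inversionK.
Qed.

(** * Angles and polar coordinates *)

Lemma cos_sinD2piz (R : realType) (x : R) (z : int) :
  cos (x + 2 * pi * z%:~R) = cos x /\ sin (x + 2 * pi * z%:~R) = sin x.
Proof.
have nat_case (y : R) n : cos (y + 2 * pi * n%:R) = cos y /\
                          sin (y + 2 * pi * n%:R) = sin y.
  have -> : 2 * pi * n%:R = (pi *+ 2) *+ n :> R by rewrite mulr_natr mulr_natl.
  by rewrite (periodicn (@cosD2pi R)) (periodicn (@sinD2pi R)).
case: z => n; first exact: nat_case.
have [c s] := nat_case (x + 2 * pi * (Negz n)%:~R) n.+1.
by rewrite -c -s; split; congr (_ _); rewrite NegzE mulrNz; ring.
Qed.

Lemma cos_eq_small (R : realType) (x y : R) :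
  `|x| <= pi -> `|y| <= pi -> cos x = cos y -> x = y \/ x = - y.
Proof.
move=> xpi ypi xy.
have : `|x| = `|y|.
  by apply: cos_inj; rewrite ?in_itv /= ?normr_ge0 //= !cos_norm.
by move/eqP; rewrite eqr_norm2 => /orP[/eqP|/eqP]; [left | right].
Qed.

Lemma cos_sqr1_small (R : realType) (x : R) :
  `|x| < pi -> cos x ^+ 2 = 1 -> x = 0.
Proof.
move=> xpi; have npi : `|pi| = pi :> R by rewrite ger0_norm ?pi_ge0.
move/eqP; rewrite sqrf_eq1 => /orP[/eqP cx|/eqP cx].
  have [] := @cos_eq_small _ x 0 (ltW xpi); rewrite ?oppr0 ?cos0 //.
  by rewrite normr0 pi_ge0.
have : `|x| = pi; last by move=> xE; rewrite xE ltxx in xpi.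
have [] := @cos_eq_small _ x pi (ltW xpi); rewrite ?npi ?cospi // => ->;
  by rewrite ?normrN.
Qed.

Definition polar (R : realType) (O : R * R) (r t : R) : R * R :=
  (O.1 + r * cos t, O.2 + r * sin t).

Lemma sqdist_polar (R : realType) (O : R * R) (r s t u : R) :
  sqdist (polar O r t) (polar O s u) =
  r ^+ 2 + s ^+ 2 - 2 * r * s * cos (u - t).
Proof.
rewrite cosB /sqdist /polar /=.
have ct : sin t ^+ 2 = 1 - cos t ^+ 2 by rewrite -(cos2Dsin2 t); ring.
have cu : sin u ^+ 2 = 1 - cos u ^+ 2 by rewrite -(cos2Dsin2 u); ring.
by ring: ct cu.
Qed.

Lemma sqdist_polar0 (R : realType) (O : R * R) (r t : R) :
  sqdist (polar O r t) O = r ^+ 2.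
Proof.
by rewrite /sqdist /polar /= -[RHS]mulr1 -(cos2Dsin2 t); ring.
Qed.

Lemma sqdist_polar_ray (R : realType) (O : R * R) (r s t : R) :
  sqdist (polar O r t) (polar O s t) = (r - s) ^+ 2.
Proof. by rewrite sqdist_polar subrr cos0; ring. Qed.

(** The axis bisects the angle between the directions [a] and [b] in which [C] is
    seen from [O1] and [O2], so the reflection fixes [C], swaps [O1] and [O2], and
    reverses angles. *)
Lemma reflection_polar (R : realType) (C O1 O2 : R * R) (d a b r x : R) :
  C = polar O1 d a -> C = polar O2 d b ->
  reflection C ((a + b) / 2) (polar O1 r (a + x)) = polar O2 r (b - x).
Proof.
case: C O1 O2 => [c1 c2] [p1 p2] [q1 q2] [-> ->] [E1 E2].
rewrite /reflection /polar /=.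
pose g := (a + b) / 2; pose h := (a - b) / 2.
have aE : a = g + h by rewrite /g /h; field.
have bE : b = g - h by rewrite /g /h; field.
have -> : q1 = p1 + d * cos a - d * cos b by rewrite E1; ring.
have -> : q2 = p2 + d * sin a - d * sin b by rewrite E2; ring.
rewrite -/g; clearbody g h; rewrite {}aE {}bE {E1 E2}.
have -> : g + h + x = g + (h + x) by ring.
have -> : g - h - x = g - (h + x) by ring.
rewrite !(cosB g) !(sinB g) !(cosD g) !(sinD g).
have cs : sin g ^+ 2 = 1 - cos g ^+ 2 by rewrite -(cos2Dsin2 g); ring.
by congr pair; ring: cs.
Qed.

(** * Chains between concentric circles *)

(** The two kinds of circles tangent to both of two concentric circles: for
    [tau = 1] the circle lies between them, for [tau = -1] it encloses the inner
    one and touches the two on opposite sides. *)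
Definition inscribed (R : realType) (l m k : circle R) (t tau : R) : Prop :=
  ccenter k = polar (ccenter m) ((cradius m + tau * cradius l) / 2) t /\
  cradius k ^+ 2 = ((cradius m - tau * cradius l) / 2) ^+ 2.

Lemma inscribed_inj (R : realType) (l m k k' : circle R) (t tau : R) :
  inscribed l m k t tau -> inscribed l m k' t tau -> k = k'.
Proof.
move=> [c r] [c' r']; apply: circle_ext; first by rewrite c c'.
by apply/eqP; rewrite -(eqrXn2 (n := 2)) ?ltW ?cradius_gt0 // r r'.
Qed.

(** Both tangency points lie on the line through the two centers, where they are
    the ends of a diameter of [k]. *)
Lemma tangent_concentric_inscribed (R : realType) (l m k : circle R)
    (L M : R * R) (r t : R) :
  concentric l m -> cradius l <> cradius m ->
  tangent_at k l L -> tangent_at k m M ->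
  0 < r -> M = polar (ccenter m) r t ->
  M = polar (ccenter m) (cradius m) t /\
  exists tau : R, [/\ tau = 1 \/ tau = -1, inscribed l m k t tau &
    L = polar (ccenter m) (tau * cradius l) t].
Proof.
move=> lm lmr tL tM r0 ME.
have [kL lL] := tangent_at_on tL; have [kM mM] := tangent_at_on tM.
have [_ [x Lx]] := tangent_at_collinear tL.
have [_ [y My]] := tangent_at_collinear tM.
have rE : r = cradius m.
  apply/eqP; rewrite -(eqrXn2 (n := 2)) ?ltW ?cradius_gt0 // -mM ME.
  by rewrite sqdist_polar0.
rewrite {}rE {r0} in ME; split=> //.
have y1 : 1 - y != 0.
  apply/eqP=> y1; case/eqP: (cradius_sqr_neq0 m); rewrite -mM.
  apply/sqdist_eq0; rewrite My [RHS]surjective_pairing; have -> : y = 1 by lra.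
  by congr pair; ring.
pose s := cradius m / (1 - y).
have sE : (1 - y) * s = cradius m by rewrite mulrC divfK.
have cE : ccenter k = polar (ccenter m) s t.
  have /= e1 := congr1 fst My; have /= e2 := congr1 snd My.
  rewrite ME /polar /= in e1 e2.
  rewrite [LHS]surjective_pairing /polar; congr pair;
    apply: (mulfI y1); rewrite mulrDr mulrA sE; lra.
have LE : L = polar (ccenter m) ((1 - x) * s) t.
  by rewrite Lx lm cE /polar /=; congr pair; ring.
have tauP : exists2 tau, tau = 1 \/ tau = -1 & (1 - x) * s = tau * cradius l.
  move: lL; rewrite /on_circle LE lm sqdist_polar0 => /eqP.
  rewrite eqf_sqr => /orP[]/eqP->; first by exists 1; [left | rewrite mul1r].
  by exists (-1); [right | rewrite mulN1r].
case: tauP => tau tau1 tauE; rewrite tauE in LE.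
exists tau; split=> //.
move: kM kL; rewrite /on_circle ME LE cE !sqdist_polar_ray => kM kL.
have mt : cradius m - tau * cradius l != 0.
  apply/eqP; have := cradius_gt0 m; have := cradius_gt0 l.
  by case: tau1 => ->; [move: lmr; lra | lra].
have {}sE : s = (cradius m + tau * cradius l) / 2.
  by apply: (mulfI mt); lra.
by split; rewrite -?sE // -kM sE; field.
Qed.

(** Two circles between [l] and [m] have equal radii, so they can only be tangent
    externally, and the law of cosines gives the angle. Two circles of different
    kinds can only be tangent at a point of [l] or [m], hence in equal or
    opposite directions. Two circles that both enclose the inner one are too large
    to be tangent. *)
Lemma tangent_inscribed (R : realType) (l m k k' : circle R) (N : R * R)
    (t t' tau tau' : R) :
  cradius l <> cradius m ->
  tau = 1 \/ tau = -1 -> tau' = 1 \/ tau' = -1 ->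
  inscribed l m k t tau -> inscribed l m k' t' tau' -> tangent_at k k' N ->
  `|t' - t| < pi ->
  [/\ tau = 1, tau' = 1,
      (cradius m + cradius l) ^+ 2 * (1 - cos (t' - t)) =
        2 * (cradius m - cradius l) ^+ 2
    & N = (((ccenter k).1 + (ccenter k').1) / 2,
           ((ccenter k).2 + (ccenter k').2) / 2)]
  \/ tau' = - tau /\ t' = t.
Proof.
move=> lm tau1 tau1' [kc kr] [kc' kr'] tN tt.
have [kN kN'] := tangent_at_on tN.
have [cc [x NE]] := tangent_at_collinear tN.
have D0 := sqdist_neq0 cc.
have Dcos := sqdist_polar (ccenter m) ((cradius m + tau * cradius l) / 2)
  ((cradius m + tau' * cradius l) / 2) t t'.
rewrite -kc -kc' in Dcos.
set D := sqdist _ _ in D0 Dcos.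
have xD : x ^+ 2 * D = cradius k ^+ 2.
  by rewrite -kN NE /D /sqdist /=; ring.
have xD' : (1 - x) ^+ 2 * D = cradius k' ^+ 2.
  by rewrite -kN' NE /D /sqdist /=; ring.
have l0 := cradius_gt0 l; have m0 := cradius_gt0 m.
rewrite kr in xD; rewrite kr' in xD'; clearbody D.
set c := cos _ in Dcos *.
set rl := cradius l in lm kc kr kc' kr' l0 Dcos xD xD' *; clearbody rl.
set rm := cradius m in lm kc kr kc' kr' m0 Dcos xD xD' *; clearbody rm.
have c1 : c <= 1 /\ -1 <= c by rewrite cos_le1 cos_geN1.
(* Circles of the same kind have equal radii, so they touch at the midpoint
   of their centers. *)
have same : tau' = tau -> x = 1 / 2 /\
    (rm + tau * rl) ^+ 2 * (1 - c) = 2 * (rm - tau * rl) ^+ 2.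
  move=> E; rewrite E in xD' Dcos.
  have xE : x = 1 / 2 by apply: (mulfI D0); lra.
  split=> //; rewrite xE in xD.
  by rewrite Dcos in xD; lra.
have opp : tau' = - tau -> tau' = - tau /\ t' = t.
  move=> E; split=> //; rewrite E in xD' Dcos.
  suff : c ^+ 2 = 1 by move/(cos_sqr1_small tt); lra.
  (* For circles of different kinds, the radius of each is, up to sign, the
     distance of the other from the center. *)
  pose s := (rm + tau * rl) / 2; pose s' := (rm - tau * rl) / 2.
  have s0 : (s * s') ^+ 2 != 0.
    rewrite expf_neq0 // /s /s' ; apply/eqP => ss.
    have : (rm - rl) * (rm + rl) = 0.
      by move: ss; case: tau1 => ->; lra.
    by move/eqP; rewrite mulf_eq0 => /orP[]/eqP; lra.
  have e1 : x ^+ 2 * D = s' ^+ 2 by [].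
  have e2 : (1 - x) ^+ 2 * D = s ^+ 2 by rewrite xD' /s; congr (_ ^+ 2); ring.
  have e3 : s * s' * c = (x ^+ 2 - x) * D.
    have e4 : D = s ^+ 2 + s' ^+ 2 - 2 * s * s' * c.
      by rewrite Dcos /s /s'; ring.
    lra.
  apply: (mulfI s0); rewrite mulr1 -exprMn e3.
  transitivity (x ^+ 2 * D * ((1 - x) ^+ 2 * D)); first by ring.
  by rewrite e1 e2; ring.
case: tau1 same opp => tauE; case: tau1' => tauE' same opp;
  try (by right; apply: opp; lra).
  have [xE cE] := same ltac:(lra); left; split=> //.
    by rewrite tauE mul1r in cE.
  by rewrite NE xE; congr pair; field.
have [_ cE] := same ltac:(lra); rewrite tauE in cE.
exfalso.
have : 0 < rm * rl by rewrite mulr_gt0.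
have : 0 <= (rm - rl) ^+ 2 * (1 + c) by rewrite mulr_ge0 ?sqr_ge0 //; lra.
lra.
Qed.

(** This is where [n >= 3] enters: the two neighbors of a chain circle are
    distinct. *)
Lemma ordS2_neq (n : nat) (i : 'I_n) : (3 <= n)%N -> ordS (ordS i) <> i.
Proof.
move=> n3 /(congr1 val) /=; have i_n := ltn_ord i.
have [i1|i1] := ltnP i.+1 n; last first.
  have -> : i.+1 = n by lia.
  by rewrite modnn modn_small; lia.
rewrite (modn_small i1); have [i2|i2] := ltnP i.+2 n; first by rewrite modn_small; lia.
have -> : i.+2 = n by lia.
by rewrite modnn; lia.
Qed.

(** Consecutive steps have the same angle up to sign by [tangent_inscribed]; a
    change of sign would bring the chain back to the circle before last. So the
    steps are all equal, and [n] of them make [t] turns. *)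
Lemma steiner_chain_concentric (R : realType) (n : nat) (l m : circle R)
    (k : 'I_n -> circle R) (L M N : 'I_n -> R * R) (t : int)
    (phi := 2 * pi * t%:~R / n%:R) :
  (3 <= n)%N -> concentric l m -> cradius l <> cradius m -> injective k ->
  (forall i, tangent_at (k i) l (L i)) ->
  (forall i, tangent_at (k i) m (M i)) ->
  (forall i, tangent_at (k i) (k (ordS i)) (N i)) ->
  winds (ccenter m) M t ->
  (cradius m + cradius l) ^+ 2 * (1 - cos phi) =
    2 * (cradius m - cradius l) ^+ 2 /\
  exists a : R, forall i : 'I_n,
    [/\ inscribed l m (k i) (a + i%:R * phi) 1,
        L i = polar (ccenter m) (cradius l) (a + i%:R * phi),
        M i = polar (ccenter m) (cradius m) (a + i%:R * phi)
      & N i = (((ccenter (k i)).1 + (ccenter (k (ordS i))).1) / 2,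
               ((ccenter (k i)).2 + (ccenter (k (ordS i))).2) / 2)].
Proof.
move=> n3 lm lmr k_inj tL tM tN [th [thM th_small th_turn]].
have n0 : (0 < n)%N by lia.
have place i : M i = polar (ccenter m) (cradius m) (th i) /\
    exists tau : R, [/\ tau = 1 \/ tau = -1, inscribed l m (k i) (th i) tau &
      L i = polar (ccenter m) (tau * cradius l) (th i)].
  have [r r0 ME] := thM i.
  exact: tangent_concentric_inscribed (tL i) (tM i) r0 ME.
(* The lift of the angle gains full turns when the index wraps around. *)
have wrap (i : 'I_n) k0 tau :
    inscribed l m k0 (th (ordS i)) tau <-> inscribed l m k0 (th i.+1) tau.
  rewrite /inscribed /polar /=; have [i1|i1] := ltnP i.+1 n; first by rewrite modn_small.
  have -> : i.+1 = n by have := ltn_ord i; lia.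
  by rewrite modnn th_turn; have [-> ->] := cos_sinD2piz (th 0%N) t.
have step (i : 'I_n) tau tau' : tau = 1 \/ tau = -1 -> tau' = 1 \/ tau' = -1 ->
    inscribed l m (k i) (th i) tau -> inscribed l m (k (ordS i)) (th (ordS i)) tau' ->
    _ \/ _ := fun t1 t1' s s' =>
    tangent_inscribed lmr t1 t1' s ((wrap _ _ _).1 s') (tN i) (th_small i (ltn_ord i)).
(* A circle enclosing the inner one would have two equal neighbors. *)
have between i tau : inscribed l m (k i) (th i) tau -> tau = 1 \/ tau = -1 -> tau = 1.
  move=> si [//|tau1]; exfalso.
  rewrite {}tau1 -(ord_predK i) in si; set j := ord_pred i in si.
  have [_ [tj [tj1 sj _]]] := place j.
  have [_ [ti' [ti'1 si' _]]] := place (ordS (ordS j)).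
  have [[_ E _ _]|[E thj]] := step _ _ _ tj1 (or_intror erefl) sj si; first by lra.
  have [[E' _ _ _]|[E' thi]] := step _ _ _ (or_intror erefl) ti'1 si si'.
    by lra.
  apply: (ordS2_neq (i := j) n3); apply: k_inj.
  have tjE : tj = 1 by lra.
  have ti'E : ti' = 1 by lra.
  rewrite {}tjE in sj; rewrite {}ti'E in si'.
  apply: (inscribed_inj (l := l) (m := m) (t := th (ordS j)) (tau := 1)).
    by rewrite -thi; apply/wrap.
  by apply/wrap; rewrite thj.
have {}place i : [/\ inscribed l m (k i) (th i) 1, L i = polar (ccenter m) (cradius l) (th i)
    & M i = polar (ccenter m) (cradius m) (th i)].
  have [ME [tau [tau1 si LE]]] := place i.
  have tauE := between _ _ si tau1; rewrite {}tauE in si LE.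
  by rewrite mul1r in LE.
have {}step (i : 'I_n) : (cradius m + cradius l) ^+ 2 * (1 - cos (th i.+1 - th i)) =
    2 * (cradius m - cradius l) ^+ 2 /\
    N i = (((ccenter (k i)).1 + (ccenter (k (ordS i))).1) / 2,
           ((ccenter (k i)).2 + (ccenter (k (ordS i))).2) / 2).
  have [si _ _] := place i; have [si' _ _] := place (ordS i).
  have [[_ _ e1 e2] //|[E _]] :=
    step _ _ _ (or_introl erefl) (or_introl erefl) si si'.
  by exfalso; lra.
(* Opposite consecutive steps would make the circles [i] and [i + 2] equal. *)
have const i : (i.+1 < n)%N -> th i.+2 - th i.+1 = th i.+1 - th i.
  move=> i1; have i_n : (i < n)%N by lia.
  pose i0 := Ordinal i_n.
  have i0S : ordS i0 = i.+1 :> nat by rewrite /= modn_small.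
  have [e1 _] := step i0; have [e2 _] := step (ordS i0).
  have b2 := th_small _ i1; have b1 := th_small _ i_n.
  have c12 : cos (th i.+2 - th i.+1) = cos (th i.+1 - th i).
    have ml : (cradius m + cradius l) ^+ 2 != 0.
      by rewrite expf_neq0 // gt_eqF // addr_gt0 // cradius_gt0.
    by rewrite i0S in e2; apply: (mulfI ml); lra.
  have [//|E] := cos_eq_small (ltW b2) (ltW b1) c12; exfalso.
  apply: (ordS2_neq (i := i0) n3); apply: k_inj.
  have [si _ _] := place i0; have [si' _ _] := place (ordS (ordS i0)).
  apply: (inscribed_inj (l := l) (m := m) (t := th i) (tau := 1)) => //.
  by have /wrap := si'; rewrite i0S (_ : th i.+2 = th i) //; lra.
pose d := th 1%N - th 0%N.
have diff i : (i < n)%N -> th i.+1 - th i = d.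
  by elim: i => [//|i IH] i1; rewrite const // IH //; lia.
have thE i : (i <= n)%N -> th i = th 0%N + i%:R * d.
  elim: i => [|i IH] i_n; first by rewrite mul0r addr0.
  by have := diff i i_n; rewrite (IH (ltnW i_n)) -[i.+1]addn1 natrD; lra.
have dE : d = phi.
  have nR : n%:R != 0 :> R by rewrite pnatr_eq0; lia.
  apply: (mulfI nR); have := thE n (leqnn n); rewrite th_turn /phi mulrCA divff //.
  by lra.
rewrite -dE; split; first by have [] := step (Ordinal n0); rewrite diff.
exists (th 0%N) => i; rewrite -thE; last exact/ltnW/ltn_ord.
by have [? ? ?] := place i; have [] := step i.
Qed.

(** * Two mirror chains *)

(** The inclusion lets the reflection match [C] and [D] with [A] and [B] in either
    order: it may exchange the two concentric circles. *)
Lemma same_circle_of_reflection (R : realType) (w : circle R) (Z : R * R)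
    (g : R) (A B C D : R * R) :
  (forall X, X \in [:: A; B; C; D] -> X <> ccenter w) ->
  {subset [:: inversion w C; inversion w D] <=
    [:: reflection Z g (inversion w A); reflection Z g (inversion w B)]} ->
  same_circle A B C D.
Proof.
move=> wN CD; apply/(cocyclic_same_circle (O := ccenter w)).
apply: cocyclic_inversion wN _.
apply: cocyclic_base.
apply: cocyclic_sub (cocyclic_reflection Z (inversion w A) (inversion w B) g).
move=> X; rewrite /= !inE => /or4P[]XE; rewrite ?XE ?orbT //;
  by have := CD X; rewrite !inE XE ?orbT => /(_ isT) /orP[]->; rewrite ?orbT.
Qed.

Lemma steiner_chain_inverted (R : realType) (n : nat) (l m l' m' w : circle R)
    (k : 'I_n -> circle R) (L M N : 'I_n -> R * R) (t : int)
    (phi := 2 * pi * t%:~R / n%:R) :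
  (3 <= n)%N -> steiner_chain l m k ->
  (forall i, tangent_at (k i) l (L i)) ->
  (forall i, tangent_at (k i) m (M i)) ->
  (forall i, tangent_at (k i) (k (ordS i)) (N i)) ->
  inverts_to w l l' -> inverts_to w m m' -> concentric l' m' ->
  winds (ccenter m') (fun i => inversion w (M i)) t ->
  [/\ cradius l' <> cradius m',
      (cradius m' + cradius l') ^+ 2 * (1 - cos phi) =
        2 * (cradius m' - cradius l') ^+ 2
    & exists (k' : 'I_n -> circle R) (a : R), forall i : 'I_n,
    inverts_to w (k i) (k' i) /\
    [/\ inscribed l' m' (k' i) (a + i%:R * phi) 1,
        inversion w (L i) = polar (ccenter m') (cradius l') (a + i%:R * phi),
        inversion w (M i) = polar (ccenter m') (cradius m') (a + i%:R * phi)
      & inversion w (N i) =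
        (((ccenter (k' i)).1 + (ccenter (k' (ordS i))).1) / 2,
         ((ccenter (k' i)).2 + (ccenter (k' (ordS i))).2) / 2)]].
Proof.
move=> n3 [lm k_inj _ _] tL tM tN il im lm' turns.
have n0 : (0 < n)%N by lia.
have lmr : cradius l' <> cradius m'.
  move=> /(circle_ext lm') E; rewrite E in il.
  have [_ lL] := tangent_at_on (tL (Ordinal n0)).
  by apply: (lm (L (Ordinal n0))); split=> //; rewrite -(inverts_to_inj il im).
have [k' ik] : exists k' : 'I_n -> circle R, forall i, inverts_to w (k i) (k' i).
  apply: (@fin_all_exists _ (fun=> circle R) (fun i => inverts_to w (k i))) => i.
  apply: inverts_to_exists.
  exact: tangent_circle_misses_pole il im lm' lm (tL i) (tM i).
have k'_inj : injective k'.
  move=> i j E; apply: k_inj; apply: inverts_to_inj (ik i) _.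
  by rewrite E; exact: ik.
have [eq_phi [a aP]] := steiner_chain_concentric n3 lm' lmr k'_inj
  (fun i => tangent_at_inversion (ik i) il (tL i))
  (fun i => tangent_at_inversion (ik i) im (tM i))
  (fun i => tangent_at_inversion (ik i) (ik (ordS i)) (tN i)) turns.
by split=> //; exists k', a.
Qed.

Theorem theorem4p2 (R : realType) (n : nat) (n_ge3 : (3 <= n)%N)
    (l1 m1 l2 m2 : circle R) (k1 k2 : 'I_n -> circle R)
    (L1 M1 N1 L2 M2 N2 : 'I_n -> R * R)
    (chain1 : steiner_chain l1 m1 k1)
    (chain2 : steiner_chain l2 m2 k2)
    (L1P : forall i, tangent_at (k1 i) l1 (L1 i))
    (M1P : forall i, tangent_at (k1 i) m1 (M1 i))
    (N1P : forall i, tangent_at (k1 i) (k1 (ordS i)) (N1 i))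
    (L2P : forall i, tangent_at (k2 i) l2 (L2 i))
    (M2P : forall i, tangent_at (k2 i) m2 (M2 i))
    (N2P : forall i, tangent_at (k2 i) (k2 (ordS i)) (N2 i))
    (common : forall i : 'I_n, i = 0%N :> nat -> k1 i = k2 i)
    (psi l1' m1' l2' m2' : circle R)
    (inv_l1 : inverts_to psi l1 l1') (inv_m1 : inverts_to psi m1 m1')
    (conc1 : concentric l1' m1')
    (inv_l2 : inverts_to psi l2 l2') (inv_m2 : inverts_to psi m2 m2')
    (conc2 : concentric l2' m2')
    (* after the inversion, the two chains make the same number of turns
       about their common centers, in opposite directions *)
    (t : int)
    (turns1 : winds (ccenter m1') (fun i => inversion psi (M1 i)) t)
    (turns2 : winds (ccenter m2') (fun i => inversion psi (M2 i)) (- t)) :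
  (* the images of l1 and l2 are both inner or both outer circles *)
  let same_roles :=
    (cradius l1' < cradius m1') = (cradius l2' < cradius m2') in
  [/\ forall i j, same_circle (N1 i) (N1 j) (N2 i) (N2 j),
      same_roles -> forall i j, same_circle (M1 i) (M1 j) (M2 i) (M2 j),
      same_roles -> forall i j, same_circle (L1 i) (L1 j) (L2 i) (L2 j)
    & forall i, same_circle (L1 i) (M1 i) (L2 i) (M2 i)].
Proof.
have [r1 phi1 [k1' [a P1]]] := steiner_chain_inverted n_ge3 chain1 L1P M1P N1P
  inv_l1 inv_m1 conc1 turns1.
have [r2 phi2 [k2' [b P2]]] := steiner_chain_inverted n_ge3 chain2 L2P M2P N2P
  inv_l2 inv_m2 conc2 turns2.
set phi := 2 * pi * t%:~R / n%:R in phi1 P1.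
have phiN : 2 * pi * (- t)%:~R / n%:R = - phi by rewrite /phi mulrNz; lra.
rewrite phiN cosN in phi2; rewrite phiN in P2; clearbody phi.
have n0 : (0 < n)%N by lia.
pose i0 := Ordinal n0.
have k0 : k1' i0 = k2' i0.
  have [ik1 _] := P1 i0; have [ik2 _] := P2 i0.
  by apply: inverts_to_unique ik1 _; rewrite common.
have [_ [[c1 rho1] _ _ _]] := P1 i0; have [_ [[c2 rho2] _ _ _]] := P2 i0.
rewrite k0 in c1 rho1; rewrite rho1 in rho2.
rewrite !(mul1r, mul0r, addr0) in c1 c2 rho2.
have [l10 m10 l20 m20] : [/\ 0 < cradius l1', 0 < cradius m1', 0 < cradius l2'
    & 0 < cradius m2'] by split; exact: cradius_gt0.
have diffE : cradius m1' - cradius l1' = cradius m2' - cradius l2' \/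
    cradius m1' - cradius l1' = - (cradius m2' - cradius l2').
  by move/eqP: rho2; rewrite eqf_sqr => /orP[]/eqP; [left | right]; lra.
(* The angle determines the ratio of the radii, and the common circle
   determines their difference. *)
have sumE : cradius m1' + cradius l1' = cradius m2' + cradius l2'.
  have cphi : 1 - cos phi != 0.
    apply/eqP => E; rewrite E mulr0 in phi1.
    have /eqP : (cradius m1' - cradius l1') ^+ 2 = 0 by lra.
    by rewrite sqrf_eq0 => /eqP; lra.
  apply/eqP; rewrite -(eqrXn2 (n := 2)) ?addr_ge0 ?ltW //.
  by apply/eqP; apply: (mulIf cphi); lra.
have radii : cradius m1' = cradius m2' /\ cradius l1' = cradius l2' \/
    cradius m1' = cradius l2' /\ cradius l1' = cradius m2'.
  by case: diffE; [left | right]; split; lra.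
rewrite -sumE in c2.
pose C := ccenter (k2' i0); pose g := (a + b) / 2.
have mirror r i : polar (ccenter m2') r (b + i%:R * - phi) =
    reflection C g (polar (ccenter m1') r (a + i%:R * phi)).
  by rewrite (reflection_polar _ _ c1 c2) mulrN.
have mirror_k i : ccenter (k2' i) = reflection C g (ccenter (k1' i)).
  have [_ [[-> _] _ _ _]] := P1 i; have [_ [[-> _] _ _ _]] := P2 i.
  by rewrite !mul1r -sumE mirror.
(* Exchanged radii would exchange inner and outer circles. *)
have same_radii : (cradius l1' < cradius m1') = (cradius l2' < cradius m2') ->
    cradius m1' = cradius m2' /\ cradius l1' = cradius l2'.
  by case: radii => // -[<- <-]; case: ltgtP => // E; case: r1.
have off i X : X \in [:: N1 i; M1 i; L1 i; N2 i; M2 i; L2 i] -> X <> ccenter psi.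
  have [ik1 _] := P1 i; have [ik2 _] := P2 i.
  have off1 := @tangent_at_neq_pole _ _ _ _ _ _ ik1.
  have off2 := @tangent_at_neq_pole _ _ _ _ _ _ ik2.
  rewrite !inE => /or4P[/eqP->|/eqP->|/eqP->|/or3P[]/eqP->].
  - exact: off1 (N1P i).
  - exact: off1 (M1P i).
  - exact: off1 (L1P i).
  - exact: off2 (N2P i).
  - exact: off2 (M2P i).
  - exact: off2 (L2P i).
have concyclic A B A' B' i j :
    [&& A \in [:: N1 i; M1 i; L1 i], B \in [:: N1 j; M1 j; L1 j],
        A' \in [:: N2 i; M2 i; L2 i] & B' \in [:: N2 j; M2 j; L2 j]] ->
    {subset [:: inversion psi A'; inversion psi B'] <=
      [:: reflection C g (inversion psi A); reflection C g (inversion psi B)]} ->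
    same_circle A B A' B'.
  case/and4P=> Ai Bj A'i B'j; apply: same_circle_of_reflection => X XE.
  have : (X \in [:: N1 i; M1 i; L1 i] ++ [:: N2 i; M2 i; L2 i]) ||
         (X \in [:: N1 j; M1 j; L1 j] ++ [:: N2 j; M2 j; L2 j]).
    rewrite !mem_cat.
    move: XE; rewrite inE => /predU1P[->|]; first by rewrite Ai.
    rewrite inE => /predU1P[->|]; first by rewrite Bj !orbT.
    rewrite inE => /predU1P[->|]; first by rewrite A'i !orbT.
    by rewrite inE => /eqP->; rewrite B'j !orbT.
  by case/orP; exact: off.
split.
- move=> i j; apply: (concyclic _ _ _ _ i j); rewrite ?inE ?eqxx ?orbT //.
  have N12 h : inversion psi (N2 h) = reflection C g (inversion psi (N1 h)).
    have [_ [_ _ _ ->]] := P1 h; have [_ [_ _ _ ->]] := P2 h.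
    by rewrite !mirror_k /reflection /=; congr pair; field.
  by rewrite !N12.
- move=> /same_radii[mE lE] i j.
  apply: (concyclic _ _ _ _ i j); rewrite ?inE ?eqxx ?orbT //.
  have M12 h : inversion psi (M2 h) = reflection C g (inversion psi (M1 h)).
    have [_ [_ _ -> _]] := P1 h; have [_ [_ _ -> _]] := P2 h.
    by rewrite -mE mirror.
  by rewrite !M12.
- move=> /same_radii[mE lE] i j.
  apply: (concyclic _ _ _ _ i j); rewrite ?inE ?eqxx ?orbT //.
  have L12 h : inversion psi (L2 h) = reflection C g (inversion psi (L1 h)).
    have [_ [_ -> _ _]] := P1 h; have [_ [_ -> _ _]] := P2 h.
    by rewrite -lE mirror.
  by rewrite !L12.
- move=> i; apply: (concyclic _ _ _ _ i i); rewrite ?inE ?eqxx ?orbT //.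
  have [_ [_ L1E M1E _]] := P1 i; have [_ [_ -> -> _]] := P2 i.
  rewrite L1E M1E.
  case: radii => -[<- <-]; rewrite !mirror => X; rewrite !inE //.
  by rewrite orbC.
Qed.
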